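(* Let $(a_n)_{n=1}^\infty$ be a strictly decreasing sequence of positive numbers with $a_n\to 0$ as $n\to\infty$. If there exists an integer $N\ge 1$ such that \[ \limsup_{n\to\infty} \frac{a_{n+N}}{a_n}<1, \] then for any Lebesgue measurable set $E\subset\mathbb{R}$ with positive Lebesgue measure, there exists a bi-Lipschitz map $f\colon\mathbb{R}\to\mathbb{R}$ such that $f(a_n)\in E$ for all $n\ge 1$ and $f'(0)=1$.
   Context: A map $f:\mathbb{R}\to\mathbb{R}$ is bi-Lipschitz if there exists a constant $L>1$ such that $L^{-1}|x-y|\le |f(x)-f(y)|\le L|x-y|$ for all $x,y\in\mathbb{R}$. *)

(* Defs.v *)
From HB Require Import structures.
From mathcomp Require Import all_boot all_order all_algebra.
From mathcomp Require Import all_classical all_reals all_analysis.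
Set Implicit Arguments.
Unset Strict Implicit.
Unset Printing Implicit Defensive.
Import Order.TTheory GRing.Theory Num.Theory.
Import numFieldNormedType.Exports.
Local Open Scope classical_set_scope.
Local Open Scope ring_scope.

Definition bilipschitz (R : realType) (f : R -> R) : Prop :=
  exists2 L : R, 1 < L &
    forall x y : R, L^-1 * `|x - y| <= `|f x - f y| <= L * `|x - y|.

(* The canonical [measurable] on [R] is the Borel sigma-algebra. Lebesgue
   measurability is Caratheodory measurability for the Lebesgue outer measure,
   the domain of [completed_lebesgue_measure]; see also
   [completed_caratheodory_measurable]. *)
Definition lebesgue_measurable (R : realType) (E : set R) : Prop :=
  ((@wlength R idfun)^*)%mu.-cara.-measurable E.

(* Main.v *)
(* Let D be the set of density points of E lying in E, and fix p in D. Choose r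
   in (0, 1) with a_(n+N) <= r^N a_n for large n, and cut the sequence into
   groups wherever a_(n+1) <= r a_n; every group has at most N terms. By density
   at p, a group with first term a_m can be moved into D by one translation
   p + t_m with t_m = o(a_m), because the translations that are bad for a single
   point have measure o(a_m). Translating a group as a whole keeps its internal
   gaps, however small, and distinct groups are separated by gaps comparable to
   a_m, so t is (1/2)-Lipschitz on the tail of the sequence. A supremum of
   cones extends it to a (1/2)-Lipschitz g with g(x) = o(x), and f(x) = p + x +
   g(x) handles the tail. The finitely many remaining terms are handled by
   bending f to the right of the tail, since no point of D is isolated in D from
   the right. *)
Require Import Defs.
From HB Require Import structures.
From mathcomp Require Import all_boot all_order all_algebra.
From mathcomp Require Import all_classical all_reals all_analysis.
From mathcomp Require Import measurable_realfun ring lra.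
Set Implicit Arguments.
Unset Strict Implicit.
Unset Printing Implicit Defensive.
Import Order.TTheory GRing.Theory Num.Theory.
Import numFieldNormedType.Exports.
Local Open Scope classical_set_scope.
Local Open Scope ring_scope.

(** * Lebesgue measure, density points and small translations *)

(** The pushforward by a translation agrees with Lebesgue measure on half-open intervals, and these
    determine it. *)
Lemma lebesgue_measure_addl (R : realType) (x : R) (A : set R) :
  measurable A ->
  lebesgue_measure ((fun t => x + t) @^-1` A) = lebesgue_measure A.
Proof.
move=> mA.
have mf : @measurable_fun _ _ (measurableTypeR R) (measurableTypeR R)
    setT (fun t : R => x + t).
  by apply: (@measurable_funD _ _ R) => //; exact: measurable_cst.
pose f : {mfun measurableTypeR R >-> measurableTypeR R} :=
  HB.pack (fun t : R => x + t) (isMeasurableFun.Build _ _ _ _ _ mf).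
rewrite -[LHS]/(pushforward (@lebesgue_measure R) f A).
symmetry; apply: (@lebesgue_measure_unique R
  [the measure _ _ of pushforward (@lebesgue_measure R) f]) => //.
move=> _ [[a b] _ <-] /=.
rewrite /pushforward.
have -> : f @^-1` `]a, b]%classic = `](a - x), (b - x)]%classic.
  by apply/seteqP; split=> t /=; rewrite !in_itv/= ltrBlDl lerBrDl.
rewrite !lebesgue_measure_itv/= !lte_fin ltrD2r; case: ifP => // _.
by rewrite -!EFinB; congr EFin; ring.
Qed.

(** A Caratheodory measurable set is a Borel set together with a negligible one, so by subadditivity
    the Borel part carries all the mass. *)
Lemma measurable_full_subset (R : realType) (E : set R) :
  lebesgue_measurable E -> (0 < completed_lebesgue_measure E)%E ->
  exists A : set R,
    [/\ measurable A, A `<=` E & (0 < lebesgue_measure A)%E].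
Proof.
rewrite /lebesgue_measurable -completed_caratheodory_measurable.
rewrite g_sigma_completed_algebra_genE => -[A mA [N negN <-]] E0.
move/negligible_outer_measure : negN => N0.
exists A; split => //.
apply: (lt_le_trans E0).
have := @outer_measureU2 _ _ (((@wlength R idfun)^*)%mu) A N.
by rewrite [X in (_ <= _ + X)%E]N0 adde0.
Qed.

(** Removing from a Borel part of [E] the null set where the density theorem fails changes no
    density, so every remaining point is a density point of [D] itself. *)
Lemma density_subset (R : realType) (E : set R) :
  lebesgue_measurable E -> (0 < completed_lebesgue_measure E)%E ->
  exists D : set R, [/\ measurable D, D `<=` E, D !=set0 &
    forall x, D x -> forall e, 0 < e -> \forall r \near 0^'+,
      (lebesgue_measure (ball x r `\` D) <= (e * r)%:E)%E].
Proof.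
move=> mE E0; have [A [mA AE A0]] := measurable_full_subset mE E0.
have [N [mN N0 subN]] := lebesgue_density mA.
exists (A `\` N); split.
- exact: measurableD.
- by move=> x [Ax _]; exact: AE.
- apply/set0P/eqP; rewrite setD_eq0 => AN.
  have : (lebesgue_measure A <= lebesgue_measure N)%E by rewrite le_measure ?inE.
  by rewrite N0 leNgt A0.
move=> x [Ax Nx] e e0.
have : (lebesgue_measure (A `&` ball x r) / lebesgue_measure (ball x r))%E
    @[r --> 0^'+] --> (\1_A x)%:E.
  by apply: contrapT => ncvg; exact/Nx/subN.
rewrite indicE mem_set// => /fine_cvgP[fin_ratio] /cvgr_gt.
(* The ball has length [2 * r], so a relative deficit of [e / 2] is an absolute one of [e * r]. *)
have e1 : 1 - e / 2 < 1 by lra.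
move=> /(_ _ e1) ratio.
near=> r.
have r0 : 0 < r by near: r; exact: nbhs_right_gt.
have mB : measurable (ball x r : set R) by exact: measurable_ball.
have mD : measurable (A `\` N) by exact: measurableD.
have BE : lebesgue_measure (ball x r) = (2 * r)%:E.
  by rewrite lebesgue_measure_ball ?ltW// mulr2n mulrDl mul1r.
have : 1 - e / 2 < fine (lebesgue_measure (A `&` ball x r) /
                          lebesgue_measure (ball x r))%E by near: r.
have AB : measurable (A `&` ball x r) by exact: measurableI.
have finAB : (lebesgue_measure (A `&` ball x r) < +oo)%E.
  apply: (@le_lt_trans _ _ (lebesgue_measure (ball x r))).
    by rewrite le_measure ?inE//; exact: subIsetr.
  by rewrite BE ltry.
have finAB' : lebesgue_measure (A `&` ball x r) \is a fin_num.
  by rewrite ge0_fin_numE.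
have r2 : 0 < 2 * r by lra.
rewrite BE inver gt_eqF// fineM//= ltr_pdivlMr// => H.
have sub : ball x r `\` (A `\` N) `<=` (ball x r `\` A) `|` N.
  by move=> y [By ADy]; have [Ny|Ny] := pselect (N y); [right|left; split=> // Ay; exact: ADy].
apply: (@le_trans _ _ (lebesgue_measure ((ball x r `\` A) `|` N))).
  by rewrite le_measure ?inE//; [exact: measurableD|
    apply: measurableU => //; exact: measurableD].
apply: (@le_trans _ _ (lebesgue_measure (ball x r `\` A) + lebesgue_measure N)%E).
  by apply: measureU2 => //; exact: measurableD.
rewrite N0 adde0.
have : lebesgue_measure (ball x r) = (lebesgue_measure (ball x r `\` A) +
    lebesgue_measure (ball x r `&` A))%E by exact: measureDI.
rewrite BE setIC -(fineK finAB').
case: (lebesgue_measure (ball x r `\` A)) => [s| |] //=.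
rewrite -EFinD => -[E1]; rewrite lee_fin.
have EH : (1 - e / 2) * (2 * r) = 2 * r - e * r by field.
move: H; rewrite {}EH; lra.
Unshelve. all: by end_near. Qed.

(** Otherwise [D] would miss an interval of length [r] to the right of [x], more than the [r / 2]
    that density allows. *)
Lemma density_right_accumulation (R : realType) (D : set R) (x : R) :
  measurable D ->
  (forall e, 0 < e -> \forall r \near 0^'+,
      (lebesgue_measure (ball x r `\` D) <= (e * r)%:E)%E) ->
  forall e, 0 < e -> exists2 y, D y & x < y < x + e.
Proof.
move=> mD dens e e0; near (0:R)^'+ => r.
have r0 : 0 < r by near: r; exact: nbhs_right_gt.
have re : r < e by near: r; exact: nbhs_right_lt.
have half0 : (0 : R) < 2^-1 by lra.
have : (lebesgue_measure (ball x r `\` D) <= (2^-1 * r)%:E)%E.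
  by near: r; exact: dens.
apply: contraPP => noD; apply/negP; rewrite -ltNge.
have sub : `]x, (x + r)[%classic `<=` ball x r `\` D.
  move=> y /=; rewrite in_itv/= => /andP[xy yr]; split.
    by rewrite /ball/= ltr_distlC; apply/andP; split; lra.
  by move=> Dy; apply: noD; exists y => //; apply/andP; split; lra.
have mB : measurable (ball x r : set R) by exact: measurable_ball.
apply: (@lt_le_trans _ _ (lebesgue_measure `]x, (x + r)[%classic)).
  rewrite lebesgue_measure_itv/= lte_fin; have -> : x < x + r by lra.
  by rewrite -EFinB lte_fin; lra.
by rewrite le_measure ?inE//; exact: measurableD.
Unshelve. all: by end_near. Qed.

(* The bad translations of a single point form a set of measure o(h), and a
   finite union of such sets cannot cover [0, d * h]. *)
Lemma density_common_translate (R : realType) (D : set R) (p : R) (N : nat)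
    (d : R) :
  measurable D ->
  (forall e, 0 < e -> \forall r \near 0^'+,
      (lebesgue_measure (ball p r `\` D) <= (e * r)%:E)%E) ->
  0 < d ->
  exists2 rho, 0 < rho & forall h, 0 < h < rho ->
    forall x : nat -> R, (forall i, (i < N)%N -> 0 <= x i <= h) ->
    exists2 t, 0 <= t <= d * h & forall i, (i < N)%N -> D (p + x i + t).
Proof.
(* With [d <= 1] the translated points stay within [2 * h] of [p], inside the ball of radius [3 * h]
   used below. *)
move=> mD dens; wlog d1 : d / d <= 1.
  move=> wlg d0; have [d1|d1] := leP d 1; first exact: wlg.
  have [//|//|rho rho0 H] := wlg 1.
  exists rho => // h hrho x xh; have [t /andP[t0 th] Dt] := H h hrho x xh.
  exists t => //; rewrite t0/= (le_trans th)//; case/andP: hrho => h0 _; nra.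
(* The [N] bad sets, each of measure at most [e * (3 * h)], then total less than [d * h]; the
   successor covers [N = 0]. *)
move=> d0; set e := d / (4 * N.+1%:R).
have N0 : (0 : R) < N.+1%:R by rewrite ltr0n.
have e0 : 0 < e by rewrite divr_gt0// mulr_gt0.
have := dens e e0; rewrite near_withinE => /nbhs_ballP[rho /= rho0 sub].
exists (rho / 3); first by rewrite divr_gt0.
move=> h /andP[h0 hrho] x xh; apply: contrapT => not_t.
have mB : measurable (ball p (3 * h) : set R) by exact: measurable_ball.
have bound : (lebesgue_measure (ball p (3 * h) `\` D) <= (e * (3 * h))%:E)%E.
  apply: sub => /=; last by lra.
  by rewrite /ball/= sub0r normrN gtr0_norm; lra.
pose bad i := (fun t => (p + x i) + t) @^-1` (ball p (3 * h) `\` D).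
have cover : `[0, (d * h)]%classic `<=` \big[setU/set0]_(i < N) bad i.
  move=> t /=; rewrite in_itv/= => t01; apply: contrapT => nbad.
  apply: not_t; exists t => // i iN; apply: contrapT => nD.
  apply: nbad; rewrite -bigcup_mkord; exists i => //; split => //.
  have /andP[xi0 xih] := xh i iN; case/andP: t01 => t0 tdh.
  have dh : d * h <= h by nra.
  by rewrite /ball/= ltr_distlC; apply/andP; split; lra.
have mbad i : measurable (bad i).
  rewrite -[bad i]setTI; apply: (@measurable_funD _ _ R) => //.
  exact: measurableD.
have mU : measurable (\big[setU/set0]_(i < N) bad i).
  by apply: bigsetU_measurable.
have : (lebesgue_measure `[0%R, (d * h)%R]%classic <=
    \sum_(i < N) lebesgue_measure (bad i))%E.
  apply: le_trans (Boole_inequality _ _) => //; last by move=> i _; exact: mbad.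
  by rewrite le_measure ?inE.
rewrite lebesgue_measure_itv/= lte_fin mulr_gt0// -EFinB subr0.
apply/negP; rewrite -ltNge.
apply: (@le_lt_trans _ _ (\sum_(i < N) (e * (3 * h))%:E)%E).
  apply: lee_sum => i _; rewrite /bad lebesgue_measure_addl//.
  exact: measurableD.
rewrite sumEFin lte_fin sumr_const card_ord -mulr_natl.
have NE : e * (4 * N.+1%:R) = d by rewrite /e divfK// gt_eqF// mulr_gt0.
have : d * h = 4 * (N.+1%:R * (e * h)) by rewrite -{1}NE; ring.
rewrite -natr1 => ->.
have : 0 <= N%:R * (e * h) by rewrite !mulr_ge0// ltW.
have : 0 < e * h by rewrite mulr_gt0.
by nra.
Qed.

(* [T m] nearly minimizes over the admissible values, so that it inherits every
   bound [d * a m] that some admissible value satisfies. *)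
Lemma choose_little_o (R : realType) (P : nat -> R -> Prop) (a : nat -> R) :
  (forall n, 0 < a n) -> a @ \oo --> (0 : R) ->
  (forall d, 0 < d -> exists n0, forall m, (n0 <= m)%N ->
     exists2 t, 0 <= t <= d * a m & P m t) ->
  exists (T : nat -> R) n0,
    (forall m, (n0 <= m)%N -> 0 <= T m /\ P m (T m)) /\
    forall d, 0 < d -> exists n1, forall m, (n1 <= m)%N -> T m <= d * a m.
Proof.
move=> a0 /cvgrPdist_le acvg small.
pose S m := [set t | 0 <= t /\ P m t].
have lbS m : has_lbound (S m) by exists 0 => t [].
have [n0 Sn0] := small 1 ltr01.
(* The slack [a m ^+ 2] is positive, yet at most [d / 2 * a m] as soon as [a m <= d / 2]. *)
have /choice[T TP] : forall m, exists t, (n0 <= m)%N ->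
    S m t /\ t < inf (S m) + a m ^+ 2.
  move=> m; have [n0m|] := leqP n0 m; last by exists 0.
  have hasinf : has_inf (S m).
    by split=> //; have [t /andP[t0 _] Pt] := Sn0 m n0m; exists t.
  have a2 : 0 < a m ^+ 2 by rewrite exprn_gt0.
  by have [t St ht] := inf_adherent a2 hasinf; exists t.
exists T, n0; split => [m /TP[]//|d d0].
have d2 : 0 < d / 2 by lra.
have [n1 Sn1] := small _ d2; have [n2 _ an2] := acvg _ d2.
exists (maxn n0 (maxn n1 n2)) => m; rewrite !geq_max => /and3P[m0 m1 m2].
have [_ /ltW Tm] := TP m m0; apply: (le_trans Tm).
have [t /andP[t0 tm] Pt] := Sn1 m m1.
have inft : inf (S m) <= t by apply: ge_inf.
have := an2 m m2; rewrite sub0r normrN gtr0_norm// => am.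
have am0 := a0 m; rewrite expr2; nra.
Qed.

(** * Cutting the sequence into groups of bounded size *)

Section groups.
Variables (R : realType) (b : nat -> R) (r : R) (N : nat).
Hypothesis b_gt0 : forall n, 0 < b n.
Hypothesis r01 : 0 < r < 1.
Hypothesis b_ratio : forall n, b (n + N)%N <= r ^+ N * b n.

Fixpoint group_head (n : nat) : nat :=
  if n is m.+1 then if b n <= r * b m then n else group_head m else 0%N.

Lemma group_head_le n : (group_head n <= n)%N.
Proof. by elim: n => //= n IH; case: ifP => // _; exact: leqW. Qed.

(** No cut occurs after the head up to [n], so each step there multiplies [b] by more than [r]. *)
Lemma group_head_ratio n k : (0 < k)%N -> (group_head n + k <= n)%N ->
  r ^+ k * b (group_head n) < b (group_head n + k)%N.
Proof.
have /andP[r0 _] := r01.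
elim: n k => [|n IH] [//|k] _ /=; first by rewrite addnS.
case: ifPn => [_|]; first by rewrite addnS ltnS -ltn_subRL subnn.
rewrite -ltNge => bn; rewrite leq_eqVlt => /predU1P[Ek|]; last first.
  by rewrite ltnS; exact: IH.
rewrite Ek; apply: le_lt_trans bn; rewrite exprS -mulrA ler_pM2l//.
have En : (group_head n + k)%N = n by apply/succn_inj; rewrite -addnS.
case: k Ek En => [|k] Ek En; first by rewrite expr0 mul1r -[in leRHS]En addn0.
by rewrite -[in leRHS]En; apply/ltW/IH => //; rewrite En.
Qed.

(** A group reaching [N] steps past its head would contradict [b_ratio]. *)
Lemma group_head_size n : (0 < N)%N -> (n < group_head n + N)%N.
Proof.
move=> N0; rewrite ltnNge; apply/negP => /(group_head_ratio N0).
by rewrite ltNge b_ratio.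
Qed.

Lemma group_head_lower n : (0 < N)%N -> r ^+ N * b (group_head n) <= b n.
Proof.
move=> N0; have hn := group_head_size n N0; have /andP[r0 r1] := r01.
have := group_head_le n; rewrite leq_eqVlt => /predU1P[Eh|lth].
  by rewrite -[in leRHS]Eh ger_pMl// exprn_ile1// ltW.
have En : (group_head n + (n - group_head n))%N = n by rewrite subnKC// ltnW.
have k0 : (0 < n - group_head n)%N by rewrite subn_gt0.
have := ltW (@group_head_ratio n _ k0 _).
rewrite En => /(_ (leqnn n)); apply: le_trans.
rewrite ler_pM2r// ler_wiXn2l// ?ltW// leq_subLR ltnW//.
Qed.

(** Different heads mean a cut between [n] and [m]; monotonicity spreads the drop at the cut to the
    two terms. *)
Lemma group_head_gap n m : {homo b : i j / (i <= j)%N >-> j <= i} ->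
  (n < m)%N -> group_head n = group_head m \/ b m <= r * b n.
Proof.
move=> b_decr; have /andP[r0 _] := r01; elim: m => // m IH.
rewrite ltnS => nm /=; case: ifPn => [bm|_].
  by right; apply: (le_trans bm); rewrite ler_pM2l// b_decr.
move: nm; rewrite leq_eqVlt => /predU1P[->|nm]; first by left.
by have [|bm] := IH nm; [left|right; apply: le_trans bm; exact: b_decr].
Qed.

End groups.

(** Each term takes the translation of its group head. Bounds relative to the head become bounds
    relative to the term at the cost of a factor [r ^+ N]. *)
Lemma group_translations (R : realType) (b : nat -> R) (r : R) (N : nat)
    (Q : nat -> R -> Prop) (T : nat -> R) :
  (forall n, 0 < b n) -> {homo b : i j / (i <= j)%N >-> j <= i} ->
  0 < r < 1 -> (0 < N)%N -> (forall n, b (n + N)%N <= r ^+ N * b n) ->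
  (forall m, 0 <= T m <= (1 - r) / 2 * r ^+ N * b m) ->
  (forall m i, (i < N)%N -> Q (m + i)%N (T m)) ->
  (forall d, 0 < d -> exists n1, forall m, (n1 <= m)%N -> T m <= d * b m) ->
  exists t : nat -> R,
    [/\ forall n, 0 <= t n <= (1 - r) / 2 * b n,
        forall n, Q n (t n),
        forall n m, (n < m)%N -> t n = t m \/ b m <= r * b n &
        forall d, 0 < d -> exists n1, forall n, (n1 <= n)%N -> t n <= d * b n].
Proof.
move=> b0 bdecr r01 N0 brat Tbnd QT To; pose h := group_head b r.
have /andP[r0 r1] := r01.
have hle n : (h n <= n)%N := group_head_le b r n.
have hsize n : (n < h n + N)%N := group_head_size r01 brat n N0.
have hlow n : r ^+ N * b (h n) <= b n := group_head_lower b0 r01 brat n N0.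
exists (T \o h); split => [n|n|n m nm|d d0] /=.
- have /andP[T0 TT] := Tbnd (h n); rewrite T0/= (le_trans TT)// -mulrA.
  by rewrite ler_wpM2l//; lra.
- have -> : n = (h n + (n - h n))%N by rewrite subnKC.
  by rewrite subnKC//; have := QT (h n) (n - h n)%N; rewrite subnKC//; apply;
    rewrite ltn_subLR.
- have [E|] := group_head_gap r01 bdecr nm; [left|by right].
  by rewrite /h E.
have rN : 0 < r ^+ N by rewrite exprn_gt0.
have [n1 Tn1] := To (d * r ^+ N) (mulr_gt0 d0 rN).
(* Since [n < h n + N], the extra [N] brings the head itself past [n1]. *)
exists (n1 + N)%N => n n1n.
have /Tn1 : (n1 <= h n)%N.
  by rewrite -(leq_add2r N) (leq_trans n1n)// ltnW.
by move/le_trans; apply; rewrite -mulrA ler_pM2l.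
Qed.

(** * Interpolating the translations by a Lipschitz function *)

Lemma lipschitz_bump (R : realType) (b : nat -> R) (r : R) (t : nat -> R) :
  (forall n, 0 < b n) -> {homo b : i j / (i <= j)%N >-> j <= i} -> 0 < r < 1 ->
  (forall n, 0 <= t n <= (1 - r) / 2 * b n) ->
  (forall n m, (n < m)%N -> t n = t m \/ b m <= r * b n) ->
  (forall d, 0 < d -> exists n1, forall n, (n1 <= n)%N -> t n <= d * b n) ->
  exists g : R -> R,
    [/\ forall x y, g x <= g y + `|x - y| / 2,
        forall n, g (b n) = t n &
        forall d, 0 < d -> exists2 eta, 0 < eta &
          forall x, `|x| < eta -> `|g x| <= d * `|x|].
Proof.
move=> b0 bdecr /andP[r0 r1] tbnd tgap to.
(* Cones of slope 1/2 with apex [(b n, t n)]. Including 0 makes [g] nonnegative, so only upper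
   bounds remain to be proved. *)
pose S x := [set s : R | s = 0 \/ exists n, s = t n - `|x - b n| / 2].
pose g x := sup (S x).
have S0 x : S x !=set0 by exists 0; left.
have ubS x : has_ubound (S x).
  exists (b 0%N) => s [->|[n ->]]; first exact: ltW.
  have /andP[_ tn] := tbnd n; have bn := b0 n.
  have bn0 : b n <= b 0%N by exact: bdecr.
  have := normr_ge0 (x - b n); nra.
have g_ge0 x : 0 <= g x by apply: ub_le_sup => //; left.
have g_ge x n : t n - `|x - b n| / 2 <= g x.
  by apply: ub_le_sup => //; right; exists n.
have g_le x M : 0 <= M -> (forall n, t n - `|x - b n| / 2 <= M) -> g x <= M.
  by move=> M0 tM; apply: ge_sup => // s [->|[n ->]].
exists g; split => [x y|n|d d0].
- apply: g_le => [|n]; first by have := g_ge0 y; have := normr_ge0 (x - y); lra.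
  by have := g_ge y n; have := ler_distD x y (b n); rewrite (distrC y x); lra.
- apply/eqP; rewrite eq_le; apply/andP; split; last first.
    by have := g_ge (b n) n; rewrite subrr normr0; lra.
  have /andP[tn0 tn] := tbnd n; apply: g_le => // m.
  have /andP[tm0 tm] := tbnd m; have bm := b0 m; have bn := b0 n.
  (* Within a group the apexes have equal height. Otherwise the gap is at least [1 - r] times the
     larger of [b n] and [b m], so the cone at [b m] has dropped to 0 or below at [b n]. *)
  have [nm|mn|->] := ltngtP n m; last by have := normr_ge0 (b m - b m); lra.
  + have := ler_norm (b n - b m).
    by have [<-|bmn] := tgap _ _ nm; [have := normr_ge0 (b n - b m); lra|nra].
  + have := ler_norm (b m - b n); rewrite distrC.
    by have [<-|bmn] := tgap _ _ mn; [have := normr_ge0 (b n - b m); lra|nra].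
(* The factor [r] pays for replacing [b n] by [x] when [r * b n < x]. *)
have [n1 tn1] := to (d * r) (mulr_gt0 d0 r0).
exists (r * b n1); first exact: mulr_gt0.
move=> x; rewrite ltr_norml => /andP[_ xn1]; rewrite ger0_norm//.
apply: g_le => [|n]; first by rewrite mulr_ge0// ltW.
(* a positive term forces [b n] to be comparable with [x] *)
have [bx|xb] := leP x (r * b n).
  apply: (@le_trans _ _ 0); last by rewrite mulr_ge0// ltW.
  have /andP[tn0 tn] := tbnd n; have := ler_norm (b n - x); rewrite distrC.
  by lra.
have nn1 : (n1 <= n)%N.
  rewrite leqNgt; apply/negP => /ltnW/bdecr.
  by rewrite -(ler_pM2l r0); lra.
have := tn1 n nn1; have := ler_norm x; have := normr_ge0 (x - b n).
by rewrite -mulrA; nra.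
Qed.

(** * Increasing bi-Lipschitz maps and the finitely many first terms *)

(** Signed increments add up across a gluing point, which makes this form easier to extend than
    [bilipschitz]. *)
Definition increasing_bilipschitz (R : realType) (f : R -> R) :=
  exists l L : R, [/\ 0 < l, 0 < L &
    forall x y, x <= y -> l * (y - x) <= f y - f x <= L * (y - x)].

Definition tangent_to_id (R : realType) (f : R -> R) :=
  forall d, 0 < d -> exists2 eta, 0 < eta &
    forall x, `|x| < eta -> `|f x - f 0 - x| <= d * `|x|.

Lemma increasing_bilipschitz_bilipschitz (R : realType) (f : R -> R) :
  increasing_bilipschitz f -> bilipschitz f.
Proof.
move=> [l [L [l0 L0 fP]]]; set M := 1 + L + l^-1.
have li0 : 0 < l^-1 by rewrite invr_gt0.
have M1 : 1 < M by rewrite /M; lra.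
exists M => // x y; wlog xy : x y / x <= y.
  move=> wlg; have [xy|/ltW yx] := leP x y; first exact: wlg.
  by rewrite distrC [X in _ <= X <= _]distrC; exact: wlg.
have /andP[lf fL] := fP x y xy.
have f0 : 0 <= f y - f x by apply: le_trans lf; rewrite mulr_ge0//; lra.
rewrite distrC [X in _ <= X <= _]distrC !ger0_norm//; last by lra.
have Ml : M^-1 <= l by rewrite -[leRHS]invrK lef_pV2 ?posrE//; rewrite /M; lra.
apply/andP; split.
  by apply: le_trans lf; rewrite ler_wpM2r//; lra.
by apply: (le_trans fL); rewrite ler_wpM2r//; rewrite /M; lra.
Qed.

Lemma tangent_to_id_is_derive (R : realType) (f : R -> R) :
  tangent_to_id f -> is_derive (0 : R) (1 : R) f (1 : R).
Proof.
move=> tf.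
have cf : h^-1 *: ((f \o shift 0) (h *: (1 : R)) - f 0) @[h --> 0^'] --> (1 : R).
  apply/cvgrPdist_le => d d0; have [eta eta0 feta] := tf d d0.
  near=> h.
  have h0 : h != 0 by near: h; exact: nbhs_dnbhs_neq.
  have heta : `|h| < eta by near: h; exact: dnbhs0_lt.
  rewrite /= addr0 /GRing.scale/= mulr1.
  have -> : 1 - h^-1 * (f h - f 0) = - (h^-1 * (f h - f 0 - h)) by field.
  by rewrite normrN normrM normfV mulrC ler_pdivrMr ?normr_gt0// feta.
split; first by apply/cvg_ex; exists 1.
exact/cvg_lim.
Unshelve. all: by end_near. Qed.

(** To the right of [u], [f] is replaced by the line through [(u, f u)] and [(v, w)], whose slope is
    positive. *)
Lemma bilipschitz_extend (R : realType) (f : R -> R) (u v w : R) :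
  increasing_bilipschitz f -> u < v -> f u < w ->
  exists f' : R -> R, [/\ increasing_bilipschitz f',
    forall x, x <= u -> f' x = f x & f' v = w].
Proof.
move=> [l [L [l0 L0 fP]]] uv fw; set s := (w - f u) / (v - u).
have s0 : 0 < s by rewrite divr_gt0//; lra.
exists (fun x => if x <= u then f x else f u + s * (x - u)); split.
- exists (Num.min l s), (Num.max L s); split.
  + by rewrite lt_min l0.
  + by rewrite lt_max L0.
  move=> x y xy; set m := Num.min l s; set M := Num.max L s.
  have ml : m <= l by rewrite /m ge_min lexx.
  have ms : m <= s by rewrite /m ge_min lexx orbT.
  have LM : L <= M by rewrite /M le_max lexx.
  have sM : s <= M by rewrite /M le_max lexx orbT.
  have [yu|uy] := leP y u.
    rewrite (le_trans xy yu); have /andP[h1 h2] := fP x y xy.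
    by apply/andP; split; nra.
  have [xu|ux] := leP x u; last by apply/andP; split; nra.
  by have /andP[h1 h2] := fP x u xu; apply/andP; split; nra.
- by move=> x ->.
rewrite leNgt uv/= /s divfK; last by rewrite gt_eqF// subr_gt0.
by rewrite subrKC.
Qed.

(** By induction on [n0], the last unplaced term is sent to a point of [D] beyond the image of the
    next term, altering [f] only to the right of the latter. *)
Lemma bilipschitz_extend_sequence (R : realType) (a : nat -> R) (D : set R)
    (n0 : nat) (f : R -> R) :
  (forall n, 0 < a n) -> {homo a : n m / (n < m)%N >-> m < n} ->
  (forall x, D x -> exists2 y, D y & x < y) ->
  increasing_bilipschitz f -> tangent_to_id f ->
  (forall n, (n0 <= n)%N -> D (f (a n))) ->
  exists f' : R -> R, [/\ increasing_bilipschitz f', tangent_to_id f' &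
    forall n, D (f' (a n))].
Proof.
move=> a0 adecr Dright; elim: n0 f => [|n0 IH] f fbil ftan fD.
  by exists f; split => // n; exact: fD.
have [w Dw fw] := Dright _ (fD n0.+1 (leqnn _)).
have [f' [bil' ff' f'w]] := bilipschitz_extend fbil (adecr _ _ (ltnSn n0)) fw.
apply: (IH f') => //.
  move=> d d0; have [eta eta0 feta] := ftan d d0.
  (* Below [a n0.+1], which is positive, the new map equals [f], so tangency at 0 is untouched. *)
  exists (Num.min eta (a n0.+1)); first by rewrite lt_min eta0 a0.
  move=> x; rewrite lt_min => /andP[xeta xa].
  have xu : x <= a n0.+1 := ltW (le_lt_trans (ler_norm x) xa).
  by rewrite (ff' x xu) (ff' 0 (ltW (a0 _))); exact: feta.
move=> n; rewrite leq_eqVlt => /predU1P[<-|n0n]; first by rewrite f'w.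
rewrite ff'; first exact: fD.
move: n0n; rewrite leq_eqVlt => /predU1P[<-//|n0n].
exact/ltW/adecr.
Qed.

(** * From the limsup condition to the map *)

(** Bernoulli's inequality shows that [r = 1 - (1 - q) / N] works. *)
Lemma exists_root_bound (R : realType) (q : R) (N : nat) :
  0 < q < 1 -> (0 < N)%N -> exists2 r, 0 < r < 1 & q <= r ^+ N.
Proof.
move=> /andP[q0 q1] N0.
have bernoulli (x : R) n : 0 <= x <= 1 -> 1 - n%:R * x <= (1 - x) ^+ n.
  move=> /andP[x0 x1]; elim: n => [|n IH]; first by rewrite mul0r subr0 expr0.
  rewrite exprS; apply: le_trans (ler_wpM2l _ IH); last by lra.
  by rewrite -natr1; have := ler0n R n; nra.
have N1 : 1 <= N%:R :> R by rewrite ler1n.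
set x := (1 - q) / N%:R.
have Nx : N%:R * x = 1 - q by rewrite mulrC divfK// gt_eqF// ltr0n.
have x0 : 0 < x by rewrite divr_gt0; lra.
have x1 : x < 1 by nra.
exists (1 - x); first by apply/andP; split; lra.
have := bernoulli x N; rewrite Nx => le_q; apply: le_trans (le_q _); first by lra.
by apply/andP; split; lra.
Qed.

Lemma limn_esup_lt1_ratio (R : realType) (a : nat -> R) (N : nat) :
  (forall n, 0 < a n) ->
  (limn_esup (fun n : nat => (a (n + N)%N / a n)%:E) < 1)%E ->
  exists2 q : R, 0 < q < 1 & exists n0, forall n, (n0 <= n)%N ->
    a (n + N)%N <= q * a n.
Proof.
move=> a0 /ereal_inf_lt[_ [V [n0 _ n0V] <-]] supV.
have ratio n : (n0 <= n)%N ->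
    ((a (n + N)%N / a n)%:E <=
     ereal_sup ((fun n : nat => (a (n + N)%N / a n)%:E) @` V))%E.
  by move=> n0n; apply: ereal_sup_ubound; exists n => //; exact: n0V.
move: supV ratio; case: (ereal_sup _) => [s| |].
  (* The maximum with 1/2 makes [q] positive at once. *)
  rewrite lte_fin => s1 ratio; exists (Num.max s 2^-1).
    by rewrite lt_max gt_max s1 invr_gt0 ltr0n orbT/=; lra.
  exists n0 => n /ratio; rewrite lee_fin ler_pdivrMr// => /le_trans; apply.
  by rewrite ler_pM2r// le_max lexx.
  by rewrite ltNge leey.
by move=> _ /(_ n0 (leqnn _)); rewrite leeNy_eq.
Qed.

Lemma bilipschitz_near_density_point (R : realType) (a : nat -> R) (N : nat)
    (q : R) (D : set R) (p : R) :
  (forall n, 0 < a n) -> {homo a : i j / (i <= j)%N >-> j <= i} ->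
  a @ \oo --> (0 : R) ->
  (0 < N)%N -> 0 < q < 1 ->
  (exists n0, forall n, (n0 <= n)%N -> a (n + N)%N <= q * a n) ->
  measurable D ->
  (forall e, 0 < e -> \forall r \near 0^'+,
      (lebesgue_measure (ball p r `\` D) <= (e * r)%:E)%E) ->
  exists f : R -> R, [/\ increasing_bilipschitz f, tangent_to_id f &
    exists n0, forall n, (n0 <= n)%N -> D (f (a n))].
Proof.
move=> a0 adecr acvg N0 q01 [n0 aratio] mD dens.
have [r r01 qr] := exists_root_bound q01 N0.
have /andP[r0 r1] := r01.
have small d : 0 < d -> exists n0, forall m, (n0 <= m)%N ->
    exists2 t, 0 <= t <= d * a m &
      forall i, (i < N)%N -> D (p + a (m + i)%N + t).
  move=> d0; have [rho rho0 translate] := density_common_translate N mD dens d0.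
  have /cvgrPdist_lt/(_ _ rho0)[n1 _ an1] := acvg.
  exists n1 => m n1m; apply: translate => [|i _].
    by rewrite a0; have := an1 m n1m; rewrite sub0r normrN gtr0_norm.
  by rewrite ltW ?a0// adecr// leq_addr.
have [T [n1 [Tn1 To]]] := choose_little_o a0 acvg small.
(* The factor [r ^+ N] is lost from head to term; the remaining [(1 - r) / 2] is what makes the
   cones compatible. *)
have kappa0 : 0 < (1 - r) / 2 * r ^+ N by rewrite mulr_gt0 ?exprn_gt0//; lra.
have [n2 Tn2] := To _ kappa0.
(* Dropping the first [k] terms makes all the eventual estimates hold from index 0. *)
pose k := maxn n0 (maxn n1 n2).
have kP n : [/\ (n0 <= n + k)%N, (n1 <= n + k)%N & (n2 <= n + k)%N].
  by split; apply: leq_trans (leq_addl _ _);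
    rewrite /k !leq_max leqnn ?orbT.
have To' d : 0 < d -> exists n1, forall m, (n1 <= m)%N ->
    T (m + k)%N <= d * a (m + k)%N.
  move=> d0; have [n3 Tn3] := To d d0; exists n3 => m n3m.
  by apply: Tn3; rewrite (leq_trans n3m)// leq_addr.
pose b n := a (n + k)%N; pose T' m := T (m + k)%N.
have b0 n : 0 < b n by exact: a0.
have bdecr : {homo b : i j / (i <= j)%N >-> j <= i}.
  by move=> i j ij; apply: adecr; rewrite leq_add2r.
have bratio n : b (n + N)%N <= r ^+ N * b n.
  have [n0k _ _] := kP n; rewrite /b addnAC (le_trans (aratio _ n0k))//.
  by rewrite ler_pM2r.
have T'bnd m : 0 <= T' m <= (1 - r) / 2 * r ^+ N * b m.
  by have [_ /Tn1[T0 _] /Tn2 Tm] := kP m; apply/andP; split; [exact: T0|exact: Tm].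
have T'D m i : (i < N)%N -> D (p + b (m + i)%N + T' m).
  move=> iN; have [_ /Tn1[_ Dm] _] := kP m; rewrite /b addnAC; exact: Dm.
have [t [tbnd tD tgap to]] := @group_translations R b r N
  (fun n t => D (p + b n + t)) T' b0 bdecr r01 N0 bratio T'bnd T'D To'.
have [g [glip gt gtan]] := lipschitz_bump b0 bdecr r01 tbnd tgap to.
have g0 : g 0 = 0.
  have [eta eta0 geta] := gtan 1 ltr01; apply/eqP.
  by have := geta 0; rewrite normr0 mulr0 normr_le0; apply.
exists (fun x => p + x + g x); split.
- exists 2^-1, (3 / 2); split; [lra|lra|move=> x y xy].
  have := glip x y; have := glip y x; rewrite distrC ler0_norm ?subr_le0//.
  by move=> h1 h2; apply/andP; split; lra.
- move=> d d0; have [eta eta0 geta] := gtan d d0; exists eta => // x xeta.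
  by rewrite g0; have -> : p + x + g x - (p + 0 + 0) - x = g x
    by [ring|]; exact: geta.
exists k => n kn; have := tD (n - k)%N; rewrite -gt /b subnK//.
Qed.

(* [a n] is the (n+1)-st term of the sequence. *)
Theorem theorem1p1 (R : realType) (a : R^nat)
    (a_decr : decreasing_seq a)
    (a_gt0 : forall n : nat, 0 < a n)
    (a_cvg0 : a @ \oo --> (0 : R))
    (a_limsup : exists2 N : nat, (1 <= N)%N &
       (limn_esup (fun n : nat => (a (n + N)%N / a n)%:E) < 1)%E)
    (E : set R)
    (E_meas : lebesgue_measurable E)
    (E_gt0 : (0 < completed_lebesgue_measure E)%E) :
  exists f : R -> R,
    [/\ bilipschitz f,
        forall n : nat, E (f (a n))
      & is_derive (0 : R) (1 : R) f (1 : R)].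
Proof.
have [N N0 limsupN] := a_limsup.
have [q q01 ratio] := limn_esup_lt1_ratio a_gt0 limsupN.
have [D [mD DE [p Dp] dens]] := density_subset E_meas E_gt0.
(* [decreasing_seq] is an equivalence between the two orders, so it gives both the weak and the
   strict monotonicity. *)
have a_noninc : {homo a : i j / (i <= j)%N >-> j <= i}.
  by move=> i j ij; rewrite a_decr.
have a_dec : {homo a : i j / (i < j)%N >-> j < i}.
  by move=> i j ij; rewrite ltNge a_decr -ltnNge.
have [f [fbil ftan [n0 fD]]] := bilipschitz_near_density_point a_gt0 a_noninc
  a_cvg0 N0 q01 ratio mD (dens p Dp).
have Dright x : D x -> exists2 y, D y & x < y.
  move=> Dx; have [y Dy /andP[xy _]] :=
    density_right_accumulation mD (dens x Dx) (@ltr01 R).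
  by exists y.
have [h [hbil htan hD]] :=
  bilipschitz_extend_sequence a_gt0 a_dec Dright fbil ftan fD.
exists h; split => [|n|].
- exact: increasing_bilipschitz_bilipschitz.
- exact: DE.
- exact: tangent_to_id_is_derive.
Qed.
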